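(* Let $K$ be a compact Hausdorff space. For a subset $A$ of $C_a(K)$ that is Hausdorff (in the subspace topology), the following are equivalent: (i) $A$ is compact; (ii) $A$ is countably compact and $\mathrm{cl}_{C_p(K)}A\subseteq\downarrow A$; (iii) $A$ is sequentially compact and $\mathrm{cl}_{C_p(K)}A\subseteq\downarrow A$. Moreover, in the affirmative case, $A$ is Fréchet–Urysohn and thus angelic.
   Context: $C_a(K)$ is the set $C(K)$ of continuous functions $f:K\to\mathbb R$ equipped with the topology having as basis the sets $\{g: g(x)<f(x)+\epsilon\ \forall x\in F\}$, for $f\in C(K)$, $\epsilon>0$ and finite $F\subseteq K$. Equivalently, a net $(f_\alpha)$ converges to $f$ iff $\limsup_\alpha f_\alpha(x)\le f(x)$ for all $x\in K$. $C_p(K)$ is $C(K)$ with the topology of pointwise convergence. $\downarrow A=\{f\in C(K):\exists g\in A,\ f\le g\text{ pointwise}\}$. Topological spaces are not assumed Hausdorff; compactness properties of $A$ and the final conclusion refer to the subspace topology from $C_a(K)$. A set $A$ is compact (resp. countably compact) if every open cover (resp. countable open cover) of $A$ has a finite subcover, and sequentially compact if every sequence in $A$ has a subsequence converging in $A$. A space $X$ is Fréchet–Urysohn if for every $B\subseteq X$ and every $b\in\mathrm{cl}\,B$ there is a sequence in $B$ converging to $b$. A subset $B$ of a space $X$ is relatively compact (resp. relatively countably compact) in $X$ if every open cover (resp. countable open cover) of $X$ has a finite subfamily covering $B$. A space $X$ is angelic if for every relatively countably compact $B\subseteq X$, $B$ is relatively compact and each $b\in\mathrm{cl}\,B$ is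 the limit of a sequence in $B$. *)

(* Defs.v *)
From HB Require Import structures.
From mathcomp Require Import all_boot all_order all_algebra finmap.
From mathcomp Require Import all_classical all_reals all_analysis.

Set Implicit Arguments.
Unset Strict Implicit.
Unset Printing Implicit Defensive.

Import Order.TTheory GRing.Theory Num.Theory.
Import numFieldNormedType.Exports.

Local Open Scope classical_set_scope.
Local Open Scope ring_scope.

(* Ca K R and Cp K R are aliases of the same type of continuous functions, so
   that a set of one is, by conversion, a set of the other; only the topology
   inferred from the alias differs. *)
Definition Ca (K : topologicalType) (R : realType) : Type := continuousType K R.

Definition Cp (K : topologicalType) (R : realType) : Type := continuousType K R.

Section Ca_topology.
Variables (K : topologicalType) (R : realType).

HB.instance Definition _ := Choice.copy (Ca K R) (continuousType K R).

Definition fun_of_Ca (f : Ca K R) : K -> R :=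
  Continuous.sort (f : continuousType K R).

Local Coercion fun_of_Ca : Ca >-> Funclass.

Definition Ca_basic (f : Ca K R) (F : set K) (e : R) : set (Ca K R) :=
  [set g | forall x, F x -> g x < f x + e].

Definition Ca_base : set (set (Ca K R)) :=
  [set U | exists f F e, [/\ finite_set F, 0 < e & U = Ca_basic f F e]].

Lemma Ca_base_cover : \bigcup_(U in Ca_base) id U = setT.
Proof.
rewrite predeqE => f; split=> // _; exists (Ca_basic f set0 1) => //.
by exists f, set0, 1; split=> //; exact: ltr01.
Qed.

Lemma Ca_basic_shrink (f t : Ca K R) (F : set K) (e : R) :
  finite_set F -> Ca_basic f F e t ->
  exists2 d : R, 0 < d & forall x, F x -> t x + d <= f x + e.
Proof.
move=> /finite_seqP[s ->] {F}; elim: s => [|a s IH] ft.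
  by exists 1; [exact: ltr01|].
have [|d d0 dP] := IH; first by move=> x /= xs; apply: ft; rewrite /= inE xs orbT.
have ta : t a < f a + e by apply: ft; rewrite /= inE eqxx.
exists (Order.min d (f a + e - t a)); first by rewrite lt_min d0 subr_gt0.
move=> x /=; rewrite inE => /orP[/eqP->|xs].
  by rewrite -lerBrDl ge_min lexx orbT.
by apply: le_trans (dP _ xs); rewrite lerD2l ge_min lexx.
Qed.

Lemma Ca_base_join (U V : set (Ca K R)) (t : Ca K R) :
  Ca_base U -> Ca_base V -> id U t -> id V t ->
  exists W : set (Ca K R), [/\ Ca_base W, id W t & id W `<=` id U `&` id V].
Proof.
move=> [f [F [e [finF _ ->]]]] [g [G [c [finG _ ->]]]] /= ft gt.
have [d d0 dP] := Ca_basic_shrink finF ft.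
have [d' d'0 dP'] := Ca_basic_shrink finG gt.
exists (Ca_basic t (F `|` G) (Order.min d d')); split.
- exists t, (F `|` G), (Order.min d d'); split=> //.
    by rewrite finite_setU.
  by rewrite lt_min d0.
- by move=> x _; rewrite ltrDl lt_min d0.
- move=> h ht; split=> x Hx.
    apply: lt_le_trans (ht _ (or_introl Hx)) _.
    by apply: le_trans (dP _ Hx); rewrite lerD2l ge_min lexx.
  apply: lt_le_trans (ht _ (or_intror Hx)) _.
  by apply: le_trans (dP' _ Hx); rewrite lerD2l ge_min lexx orbT.
Qed.

HB.instance Definition _ :=
  isBaseTopological.Build (Ca K R) Ca_base_cover Ca_base_join.

End Ca_topology.

HB.instance Definition _ (K : topologicalType) (R : realType) :=
  Topological.copy (Cp K R)
    (initial_topology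
       ((fun f => Continuous.sort f) : continuousType K R -> {ptws K -> R})).

Definition down_closure (K : topologicalType) (R : realType)
    (A : set (Ca K R)) : set (Ca K R) :=
  [set f | exists2 g, A g & forall x, fun_of_Ca f x <= fun_of_Ca g x].

(* Counterpart of cover_compact; the families (f i)_(i in D) with D : set nat
   are, up to reindexing, all the finite or countably infinite ones. *)
Definition countably_compact (T : topologicalType) (A : set T) : Prop :=
  forall (D : set nat) (f : nat -> set T),
    (forall i, D i -> open (f i)) -> A `<=` cover D f ->
    finite_subset_cover D f A.

Definition sequentially_compact (T : topologicalType) (A : set T) : Prop :=
  forall u : nat -> T, (forall n, A (u n)) ->
    exists2 s : nat -> nat, {homo s : m n / (m < n)%N} &
      exists2 l : T, A l & (u \o s) @ \oo --> l.

Definition frechet_urysohn (X : topologicalType) : Prop :=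
  forall (B : set X) (b : X), closure B b ->
    exists2 u : nat -> X, (forall n, B (u n)) & u @ \oo --> b.

Definition relatively_compact (X : topologicalType) (B : set X) : Prop :=
  forall (I : choiceType) (D : set I) (f : I -> set X),
    (forall i, D i -> open (f i)) -> [set: X] `<=` cover D f ->
    finite_subset_cover D f B.

Definition relatively_countably_compact (X : topologicalType)
    (B : set X) : Prop :=
  forall (D : set nat) (f : nat -> set X),
    (forall i, D i -> open (f i)) -> [set: X] `<=` cover D f ->
    finite_subset_cover D f B.

Definition angelic (X : topologicalType) : Prop :=
  forall B : set X, relatively_countably_compact B ->
    relatively_compact B /\
    forall b : X, closure B b ->
      exists2 u : nat -> X, (forall n, B (u n)) & u @ \oo --> b.

Arguments frechet_urysohn : clear implicits.
Arguments angelic : clear implicits.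

(* Main.v *)
From HB Require Import structures.
Require Import Defs.
From mathcomp Require Import all_boot all_order all_algebra finmap.
From mathcomp Require Import all_classical all_reals all_analysis.
Import Order.TTheory GRing.Theory Num.Theory.
Import numFieldNormedType.Exports.

Local Open Scope classical_set_scope.
Local Open Scope ring_scope.
Set Implicit Arguments.
Unset Strict Implicit.
Unset Printing Implicit Defensive.

(** A basic neighbourhood of [f] in [C_a(K)] only bounds functions from above, on
finitely many points, so a limit may lie far above the functions converging to
it.  In return each function is genuinely continuous on the compact space [K],
and a tuple of points of [K] that is bad for every finite part of a set of
functions has a limit that is bad for all of it ([tuple_compactness]).  This is
the only way in which the compactness of [K]^n enters, and it already gives
countable tightness ([countable_tightness]).

Fréchet-Urysohn and sequential compactness of a compact Hausdorff [X].  Let [u]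
be a sequence in [X] and [b] a point of [X].  Choose a countable [D] in [K] such
that every point [y] of [K] has a twin [y'] in the closure of [D] at which [b]
and all [u n] take the same values as at [y].  If [f] is in the closure of [u]
and [f <= b] on [D], then [f <= b] at all twins, by continuity of [f].  Were [f]
different from [b], take disjoint neighbourhoods of the two, and move the points
that define the one of [b] to their twins: [f] is inside the moved
neighbourhood, which contains the same [u n] as before, a contradiction
([closure_range_separated]).  So [b] is a G_delta point of the compact closure
of [u], hence a point of countable character there ([range_countable_base]), and
convergent sequences can be picked directly.

Countable compactness implies compactness when [X] is Hausdorff.  Suppose that
an open cover has no finite subcover, and call a closed set large if no finite
number of members cover it.  Any large set has a large closed subset that lies
in, or misses, a given open set ([large_decide]).  One builds a sequence [u] and
decreasing large sets [Q n], with [u n] in [Q n], which decide every open set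
[tuple_below s n e] attached to a finite set [s] of terms of [u]: the functions
with a basic neighbourhood, given by [n] points and missing [s] by the margin
[e].  Countable compactness provides a cluster point [g] of [u], which lies in
all [Q n], and a second point [x] of all [Q n], because removing from [Q n] a
member of the cover around [g] leaves a nonempty set.  Separate [g] from [x] by
a neighbourhood [U] of [g] and a basic neighbourhood of [x].  The latter misses
every finite set of terms of [u] lying in [U]; as [Q n] does not distinguish [x]
from [g], some neighbourhood of [g] of the same size misses it too, and by
[tuple_compactness] a single neighbourhood of [g] misses all terms of [u] in
[U].  This contradicts the choice of [g]
([countably_compact_hausdorff_compact]).

Finally, if [A] is compact and [h] is not below any member of [A], the open
sets given by [g x < c], with [c < h x], cover [A], and a finite subcover
provides a pointwise neighbourhood of [h] that avoids [A]
([compact_Cp_closure]). *)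

(** * Compactness and sequences in topological spaces *)

(** A nonempty set provides the base point used in [compact_cover], and both
properties are trivial for the empty set. *)
Lemma compactP_cover (T : topologicalType) (A : set T) :
  compact A <-> cover_compact A.
Proof.
have [[x Ax]|A0] := pselect (A !=set0).
  pose pT : ptopologicalType := HB.pack T (isPointed.Build T x).
  by have -> : @compact T A = @cover_compact pT A by rewrite -compact_cover.
have {A0}-> : A = set0 by rewrite -subset0 => x Ax; apply: A0; exists x.
split=> [_ I D f _ _|_]; last exact: compact0.
by exists fset0.
Qed.

Lemma compact_finite_net (K : topologicalType) (N : K -> set K) :
  compact [set: K] -> (forall x, nbhs x (N x)) ->
  exists s : seq K, forall y, exists2 x, x \in s & N x y.
Proof.
move=> /compactP_cover cK nN.
have [|x _|s _ sN] := cK K setT (fun x => (N x)°).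
- by move=> x _; exact: open_interior.
- by exists x => //; exact: nN.
- exists (enum_fset s) => y; have [x /= xs /interior_subset Nxy] := sN y I.
  by exists x.
Qed.

Lemma decreasing_subset (T : Type) (Q : nat -> set T) :
  (forall n, Q n.+1 `<=` Q n) -> forall m n, (m <= n)%N -> Q n `<=` Q m.
Proof.
move=> QS m n /subnK <-; elim: (n - m)%N => // k IH x.
by rewrite addSn => /QS; exact: IH.
Qed.

Lemma cluster_decreasing_closed (T : topologicalType) (Q : nat -> set T)
    (u : nat -> T) (x : T) :
  (forall n, closed (Q n)) -> (forall n, Q n.+1 `<=` Q n) ->
  (forall n, Q n (u n)) -> cluster (u @ \oo) x -> forall n, Q n x.
Proof.
move=> clQ QS uQ clx n; apply: (clQ n) => U nU; apply: clx nU.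
by exists n => // k nk; apply: (decreasing_subset QS nk); exact: uQ.
Qed.

Section CountablyCompact.
Variable T : topologicalType.
Hypothesis T_cc : countably_compact [set: T].

Lemma countably_compact_cluster (u : nat -> T) : exists x, cluster (u @ \oo) x.
Proof.
apply: contrapT => nocl.
pose tail n := u @` [set k | (n <= k)%N].
(* Without cluster point, the complements of the closed tails cover the space;
   the last of finitely many of them misses a term of the sequence. *)
have [| x _|s _ sT] := T_cc (D := setT) (f := fun n => ~` closure (tail n)).
- by move=> n _; apply: closed_openC; exact: closed_closure.
- apply: contrapT => xcov; apply: nocl; exists x; rewrite clusterE => U uU.
  have [n _ nU] := uU.
  have clx : closure (tail n) x by apply: contrapT => nx; apply: xcov; exists n.
  by apply: closureS clx => _ [k nk <-]; exact: nU.
- pose N := (\max_(i <- enum_fset s) i)%N.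
  have [n /= ns] := sT (u N) I; apply; apply: subset_closure; exists N => //=.
  by rewrite /N; exact: leq_bigmax_seq.
Qed.

Lemma countably_compact_bigcap (Q : nat -> set T) :
  (forall n, closed (Q n)) -> (forall n, Q n !=set0) ->
  (forall n, Q n.+1 `<=` Q n) -> exists x, forall n, Q n x.
Proof.
move=> clQ /choice[u uQ] QS.
have [x clx] := countably_compact_cluster u.
by exists x; exact: (cluster_decreasing_closed clQ QS uQ clx).
Qed.

End CountablyCompact.

Lemma sequentially_countably_compact (T : topologicalType) (A : set T) :
  sequentially_compact A -> countably_compact A.
Proof.
move=> scA D f fo covA; apply: contrapT => nocov.
(* u n avoids the first n members of the cover, hence so do all later terms *)
have /choice[u uP] n : exists x, A x /\ forall i, (i < n)%N -> D i -> ~ f i x.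
  apply: contrapT => nox; apply: nocov.
  exists (seq_fset tt [seq i <- iota 0 n | `[< D i >]]).
    by move=> i; rewrite seq_fsetE mem_filter inE => /andP[/asboolP].
  move=> x Ax; apply: contrapT => xncov; apply: nox; exists x.
  split=> // i lt_in Di fx.
  apply: xncov; exists i => //; rewrite /mkset.
  by rewrite seq_fsetE mem_filter mem_iota leq0n lt_in !andbT; exact/asboolP.
have [s s_incr [l Al cvl]] := scA u (fun n => (uP n).1).
have [i Di fil] := covA l Al.
have [N _ NP] : ((u \o s) @ \oo) (f i).
  by apply/cvl/open_nbhs_nbhs; split=> //; exact: fo.
have s_ge n : (n <= s n)%N.
  by elim: n => // n IH; apply: leq_ltn_trans IH (s_incr _ _ (ltnSn n)).
have lt_is : (i < s (maxn N i.+1))%N.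
  by apply: leq_trans (s_ge _); exact: leq_maxr.
exact: ((uP _).2 _ lt_is Di (NP _ (leq_maxl N i.+1))).
Qed.

(** * Spaces of continuous functions with upper pointwise neighbourhoods *)

Section UpperPointwise.
Variables (R : realType) (K X : topologicalType) (ev : X -> K -> R).

Definition upper_nbhd (x : X) (s : seq K) (e : R) : set X :=
  [set y | {in s, forall z, ev y z < ev x z + e}].

Hypothesis K_compact : compact [set: K].
Hypothesis ev_continuous : forall x, continuous (ev x).
Hypothesis nbhs_upperP : forall x U,
  nbhs x U <-> exists s, exists2 e, 0 < e & upper_nbhd x s e `<=` U.

(** For a fixed [t], the tuples [G] at which [t] exceeds [b] by [e] somewhere form
a closed subset of the compact space of [n]-tuples, because [t] and [b] are
continuous; the hypothesis is the finite intersection property. *)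
Lemma tuple_compactness n (B : set X) (b : X) (e : R) :
  (forall s : seq X, {in s, forall t, B t} ->
     exists G : 'I_n -> K,
       {in s, forall t, exists i, ev b (G i) + e <= ev t (G i)}) ->
  exists G : 'I_n -> K, forall t, B t -> exists i, ev b (G i) + e <= ev t (G i).
Proof.
move=> HB.
pose D := [set s : seq X | {in s, forall t, B t}].
pose S (s : seq X) : set (prod_topology (fun _ : 'I_n => K)) :=
  [set G | {in s, forall t, exists i, ev b (G i) + e <= ev t (G i)}].
pose F := filter_from D S.
have FF : ProperFilter F.
  apply: filter_from_proper; last by move=> s /HB[G GP]; exists G.
  apply: filter_from_filter; first by exists [::].
  move=> s t Ds Dt; exists (s ++ t).
    by move=> x; rewrite mem_cat => /orP[/Ds|/Dt].
  by move=> G GP; split=> x xs; apply: GP; rewrite mem_cat xs ?orbT.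
have cT : compact [set G : prod_topology (fun _ : 'I_n => K) |
    forall i, [set: K] (G i)].
  exact: (@tychonoff 'I_n (fun=> K) (fun=> setT) (fun=> K_compact)).
have FT : F [set G | forall i, [set: K] (G i)] by exists [::].
have [G [_ cG]] := cT F FF FT.
exists G => t Bt; apply: contrapT => tG.
have near_lt (i : 'I_n) : \forall G' \near G, ev t (G' i) < ev b (G' i) + e.
  have lt_i : ev t (G i) < ev b (G i) + e.
    by rewrite ltNge; apply/negP => ?; apply: tG; exists i.
  have pc : {for G, continuous
      (fun G' : prod_topology (fun _ : 'I_n => K) => G' i)}.
    exact: (@proj_continuous _ (fun=> K) i).
  have ct : ev t (G' i) @[G' --> G] --> ev t (G i).
    exact: (cvg_comp _ _ pc (@ev_continuous t (G i))).
  have cb : ev b (G' i) + e @[G' --> G] --> ev b (G i) + e.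
    have h : ev b (G' i) @[G' --> G] --> ev b (G i).
      exact: (cvg_comp _ _ pc (@ev_continuous b (G i))).
    exact: (cvgD h (cvg_cst e)).
  have : \forall G' \near G, 0 < (ev b (G' i) + e) - ev t (G' i).
    by apply: (cvgr_gt _ (cvgB cb ct) 0); rewrite subr_gt0.
  by apply: filterS => G' /=; rewrite subr_gt0.
have : F (S [:: t]) by exists [:: t] => // x; rewrite inE => /eqP ->.
move=> /cG /(_ (filter_forall _ near_lt)).
move=> [G' [/(_ t (mem_head _ _)) [i Gi] /(_ i)]].
by rewrite ltNge Gi.
Qed.

Lemma nbhs_upper x s e : 0 < e -> nbhs x (upper_nbhd x s e).
Proof. by move=> e0; apply/nbhs_upperP; exists s, e. Qed.

(** For each [n] and [m], finitely many elements of [B] meet all basic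
neighbourhoods of [b] given by [n] points and the radius [1/(m+1)]: otherwise
[tuple_compactness] yields one such neighbourhood that misses [B]. *)
Lemma countable_tightness (B : set X) b :
  closure B b ->
  exists2 u : nat -> X, (forall n, B (u n)) & closure (range u) b.
Proof.
move=> clB.
have finB (nm : nat * nat) : exists s : seq X, {in s, forall t, B t} /\
    forall G : 'I_nm.1 -> K, exists2 t, t \in s &
      forall i, ev t (G i) < ev b (G i) + nm.2.+1%:R^-1.
  case: nm => n m /=; apply: contrapT => noS.
  have [s sB|G GB] := @tuple_compactness n B b m.+1%:R^-1.
    apply: contrapT => noG; apply: noS; exists s; split=> // G.
    apply: contrapT => not; apply: noG; exists G => t ts.
    apply: contrapT => noi; apply: not; exists t => // i.
    by rewrite ltNge; apply/negP => ?; apply: noi; exists i.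
  have m0 : 0 < m.+1%:R^-1 :> R by rewrite invr_gt0.
  have nG := nbhs_upper b (map G (enum 'I_n)) m0.
  have [t [/GB[i] + /(_ (G i))]] := clB _ nG.
  by rewrite map_f ?mem_enum// leNgt => /negP Gi /(_ isT).
have [S SP] := choice finB.
have [x0 [Bx0 _]] := clB _ filterT.
pose u k := if (choice.unpickle k : option (nat * nat * nat)) is Some p
            then nth x0 (S p.1) p.2 else x0.
exists u => [n|U /nbhs_upperP[s [e e0 sU]]].
  rewrite /u; case: choice.unpickle => // p.
  have [lt|ge] := ltnP p.2 (size (S p.1)); last by rewrite nth_default.
  by apply: (SP p.1).1; rewrite mem_nth.
have [m _ /(_ _ (leqnn m)) /= me] := near_infty_natSinv_lt (PosNum e0).
have [t ts tP] := (SP (size s, m)).2 (tnth (in_tuple s)).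
exists t; split.
  exists (choice.pickle ((size s, m), index t (S (size s, m)))) => //.
  by rewrite /u choice.pickleK nth_index.
apply: sU => z /(tnthP (in_tuple s)) [i ->].
by apply: (lt_trans (tP i)); rewrite ltrD2l.
Qed.

(** The pseudometric on [K] that the functions [u n] generate is totally bounded,
so it has a countable dense set; compactness turns density into an exact
statement: [y'] is a cluster point, in [K], of points of [D] that approximate
[y] for more and more of the functions. *)
Lemma countable_dense_image (u : nat -> X) :
  exists D : nat -> seq K, forall y, exists2 y',
    (forall n, ev (u n) y' = ev (u n) y) &
    closure [set d | exists n, d \in D n] y'.
Proof.
have finD n : exists s : seq K, forall y, exists2 d, d \in s &
    forall i : 'I_n, `|ev (u i) d - ev (u i) y| < n.+1%:R^-1.
  apply: (compact_finite_net K_compact) => x.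
  apply: filter_forall => i.
  by have /cvgrPdist_lt := @ev_continuous (u i) x; apply; rewrite invr_gt0.
have [D DP] := choice finD.
exists D => y.
have /choice[d dP] : forall n, exists d, d \in D n /\
    forall i : 'I_n, `|ev (u i) d - ev (u i) y| < n.+1%:R^-1.
  by move=> n; have [d dD dy] := DP n y; exists d.
have dT : (d @ \oo) [set: K] by exact: filterT.
have [y' [_ cly']] := K_compact (fmap_proper_filter d _) dT.
exists y' => [i|U nU]; last first.
  have dU : (d @ \oo) [set d | exists n, d \in D n].
    by exists 0 => // n _ /=; exists n; have [] := dP n.
  by have [z [? ?]] := cly' _ _ dU nU; exists z.
apply/eqP; rewrite -subr_eq0 -normr_eq0 eq_le normr_ge0 andbT leNgt.
apply/negP => /divr_gt0 - /(_ _ (ltr0n _ 2)) /= e0.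
set e := _ / _ in e0.
have near_y' : \forall z \near y', `|ev (u i) y' - ev (u i) z| < e.
  by have /cvgrPdist_lt := @ev_continuous (u i) y'; apply.
have [m _ me] := near_infty_natSinv_lt (PosNum e0).
have dU : (d @ \oo) [set z | `|ev (u i) z - ev (u i) y| < e].
  exists (maxn m i.+1) => // n /=; rewrite geq_max => /andP[mn ni].
  by apply: lt_trans (me n mn); exact: ((dP n).2 (Ordinal ni)).
have [z [zy zy']] := cly' _ _ dU near_y'.
have : `|ev (u i) y' - ev (u i) y| < e + e.
  rewrite -(subrKA (ev (u i) z)).
  exact: le_lt_trans (ler_normD _ _) (ltrD zy' zy).
by rewrite /e -splitr ltxx.
Qed.

Hypothesis X_hausdorff : hausdorff_space X.

(** The function [f] need not be compatible with the twins that
[countable_dense_image] provides for [b] and the [u n]; but [f <= b] holds at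
every twin, so [f] lies in the neighbourhood of [b] moved to the twins.  That
neighbourhood has the same trace on [range u] as the original one, and a
neighbourhood of [f] always meets this trace. *)
Lemma closure_range_separated (u : nat -> X) (b : X) :
  exists D : nat -> seq K, forall f, closure (range u) f ->
    (forall n, {in D n, forall d, ev f d <= ev b d}) -> f = b.
Proof.
pose u' n := if n is m.+1 then u m else b.
have [D Ddense] := countable_dense_image u'.
exists D => f clf fb.
have {}fb y : closure [set d | exists n, d \in D n] y -> ev f y <= ev b y.
  move=> cly; rewrite -subr_ge0 leNgt; apply/negP => lt0.
  have cvg : ev b z - ev f z @[z --> y] --> ev b y - ev f y.
    exact: (cvgB (@ev_continuous b y) (@ev_continuous f y)).
  have [z [[n zn]]] := cly _ (cvgr_lt _ cvg 0 lt0).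
  by rewrite /= subr_lt0 ltNge (fb n).
apply: X_hausdorff => U V nU /nbhs_upperP[s [e e0 sV]].
have /choice[p pP] : forall y, exists y',
    (forall n, ev (u' n) y' = ev (u' n) y) /\
    closure [set d | exists n, d \in D n] y'.
  by move=> y; have [y' ? ?] := Ddense y; exists y'.
have nb : nbhs f (upper_nbhd b (map p s) e).
  apply: filterS (nbhs_upper f (map p s) e0) => g gf z zs.
  apply: lt_le_trans (gf z zs) _; rewrite lerD2r; apply: fb.
  by have /mapP[y _ ->] := zs; case: (pP y).
have [_ [[k _ <-] [Uk bk]]] := clf _ (filterI nU nb).
exists (u k); split=> //; apply: sV => z zs.
by have := bk _ (map_f p zs); rewrite ((pP z).1 k.+1) ((pP z).1 0).
Qed.

(** * Countably compact Hausdorff spaces of functions are compact *)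

Section NonCompact.
Variables (I : choiceType) (D : set I) (f : I -> set X).
Hypothesis f_open : forall i, D i -> open (f i).
Let small := finite_subset_cover D f.

Let small_subset (Q Q' : set X) : Q `<=` Q' -> small Q' -> small Q.
Proof.
by move=> QQ' [s sD Q's]; exists s => //; exact: subset_trans QQ' Q's.
Qed.

Let smallU (Q Q' : set X) : small Q -> small Q' -> small (Q `|` Q').
Proof.
move=> [s sD Qs] [t tD Q't]; exists (fsetU s t).
  by move=> i; rewrite in_fsetU => /orP[/sD|/tD].
move=> x [/Qs|/Q't] [i /= ist fix_]; exists i => //=;
  by rewrite in_fsetU ist ?orbT.
Qed.

(** Take [Q] minus [W] if it is large.  Otherwise it has a finite subcover, and
removing from [Q] the union of that subcover leaves a large closed part of
[W]. *)
Lemma large_decide (W Q : set X) : open W -> closed Q -> ~ small Q ->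
  exists Q', [/\ closed Q', ~ small Q', Q' `<=` Q &
    forall x y, Q' x -> Q' y -> W x -> W y].
Proof.
move=> oW clQ lQ.
have [[s sD QWs]|lQW] := pselect (small (Q `\` W)); last first.
  exists (Q `\` W); split=> //; last by move=> x y [].
  by rewrite setDE; apply: closedI => //; exact: open_closedC.
pose V := cover [set` (s : {fset I})] f.
have oV : open V by apply: bigcup_open => i /sD; rewrite inE; exact: f_open.
have sV : small V by exists s.
exists (Q `\` V); split.
- by rewrite setDE; apply: closedI => //; exact: open_closedC.
- move=> sQV; apply: lQ; apply: (small_subset _ (smallU sQV sV)) => x Qx.
  by have [Vx|nVx] := pselect (V x); [right|left].
- by move=> x [].
- by move=> x y _ [Qy nVy] _; apply: contrapT => nWy; apply: nVy; apply: QWs.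
Qed.

Lemma large_decide_seq (W : nat -> set X) n (Q : set X) :
  (forall c, open (W c)) -> closed Q -> ~ small Q ->
  exists Q', [/\ closed Q', ~ small Q', Q' `<=` Q &
    forall c, (c < n)%N -> forall x y, Q' x -> Q' y -> W c x -> W c y].
Proof.
move=> oW clQ lQ; elim: n => [|n [Q1 [cl1 l1 Q1Q W1]]].
  by exists Q; split.
have [Q2 [cl2 l2 Q21 W2]] := large_decide (oW n) cl1 l1.
exists Q2; split=> //; first exact: (subset_trans Q21).
move=> c; rewrite ltnS leq_eqVlt => /orP[/eqP->//|cn] x y /Q21 Q1x /Q21 Q1y.
exact: W1 cn _ _ Q1x Q1y.
Qed.

End NonCompact.

(** The [x] with a basic neighbourhood, given by [n] points and of radius larger
than [e], that contains no member of [s].  Fixing [n] and [e] is what allows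
[tuple_compactness] to pass to the limit along larger and larger [s]; the strict
inequality makes the set open for a finite [s]. *)
Definition tuple_below (s : seq X) n (e : R) : set X :=
  [set x | exists G : 'I_n -> K,
    {in s, forall t, exists i, ev x (G i) + e < ev t (G i)}].

Lemma tuple_below_open s n e : open (tuple_below s n e).
Proof.
rewrite openE => x [G GP]; rewrite /interior.
have : \forall y \near x, forall j : 'I_(size s),
    exists i, ev y (G i) + e < ev (tnth (in_tuple s) j) (G i).
  apply: filter_forall => j; have [i lt_i] := GP _ (mem_tnth j (in_tuple s)).
  have d0 : 0 < ev (tnth (in_tuple s) j) (G i) - e - ev x (G i).
    by rewrite subr_gt0 ltrBrDr.
  apply: filterS (@nbhs_upper x [:: G i] _ d0) => y /(_ (G i) (mem_head _ _)).
  by rewrite subrKC ltrBrDr; exists i.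
by apply: filterS => y yP; exists G => t /seq_tnthP[j ->].
Qed.

(** A bookkeeping construction: there are countably many triples made of a finite
set of indices, a size [n] and a margin [1/(m+1)], and once [u] is known up to
these indices the corresponding open set is decided by some later [Q N]. *)
Lemma exists_deciding_sequence (I : choiceType) (D : set I)
    (f : I -> set X) : (forall i, D i -> open (f i)) ->
  ~ finite_subset_cover D f [set: X] ->
  exists (u : nat -> X) (Q : nat -> set X),
    [/\ forall n, closed (Q n), forall n, ~ finite_subset_cover D f (Q n),
        forall n, Q n.+1 `<=` Q n, forall n, Q n (u n) &
        forall s n m, {in s, forall t, range u t} ->
          exists N, forall x y, Q N x -> Q N y ->
            tuple_below s n m.+1%:R^-1 x -> tuple_below s n m.+1%:R^-1 y].
Proof.
move=> f_open lX.
have large_ne Q : ~ finite_subset_cover D f Q -> Q !=set0.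
  move=> lQ; apply: contrapT => Q0; apply: lQ; exists fset0 => // x Qx.
  by case: Q0; exists x.
have [x0 _] := large_ne _ lX.
(* The index lists are read off codes c, and refer to the terms in the history
   h; a code that is read too early, with indices outside h, decides a useless
   set because of the default x0, and is read again at all later stages. *)
pose W (h : seq X) (c : nat) : set X :=
  if choice.unpickle c is Some (l, n, m) then
    tuple_below (map (nth x0 h) l) n m.+1%:R^-1 else setT.
have oW h c : open (W h c).
  rewrite /W; case: choice.unpickle => [[[l n] m]|]; last exact: openT.
  exact: tuple_below_open.
pose state :=
  {hQ : seq X * set X | closed hQ.2 /\ ~ finite_subset_cover D f hQ.2}.
pose step (a b : state) := exists2 x, (sval a).2 x &
  [/\ (sval b).1 = rcons (sval a).1 x, (sval b).2 `<=` (sval a).2 &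
   forall c, (c <= size (sval a).1)%N -> forall y z, (sval b).2 y ->
     (sval b).2 z -> W (sval b).1 c y -> W (sval b).1 c z].
have later (a : state) : {b : state | step a b}.
  apply: cid; case: a => -[h Q] /= [clQ lQ].
  have [x Qx] := large_ne _ lQ.
  have [Q' [clQ' lQ' QQ' WQ']] :=
    large_decide_seq f_open (size h).+1 (oW (rcons h x)) clQ lQ.
  by exists (exist _ (rcons h x, Q') (conj clQ' lQ')); exists x.
have [g [g0 gS]] := dependent_choice later
  (exist _ ([::], setT) (conj closedT lX) : state).
pose h n := (sval (g n)).1; pose Q n := (sval (g n)).2.
have /choice[u uP] n : exists x, Q n x /\ h n.+1 = rcons (h n) x.
  by have [x Qx [? _ _]] := gS n; exists x.
have hE n : h n = mkseq u n.
  elim: n => [|n IH]; first by rewrite /h g0.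
  by rewrite (uP n).2 IH /mkseq -addn1 iotaD map_cat cats1.
exists u, Q; split=> [n|n|n|n|s n m su].
- exact: (svalP (g n)).1.
- exact: (svalP (g n)).2.
- by have [? ? []] := gS n.
- exact: (uP n).1.
have [l ls] : exists l, s = map u l.
  elim: s su => [|t s IH] su; first by exists [::].
  have [l ->] := IH (fun z zs => su z (@mem_behead _ (t :: s) z zs)).
  by have [k _ <-] := su t (mem_head _ _); exists (k :: l).
pose c := choice.pickle (l, n, m); pose N := maxn c (\max_(k <- l) k)%N.
have [_ _ [_ _ /(_ c)]] := gS N.
rewrite -/(h N) -/(h N.+1) -/(Q N.+1) hE size_mkseq => /(_ (leq_maxl _ _)) WQ.
exists N.+1; move: WQ; rewrite hE /W choice.pickleK.
suff -> : [seq nth x0 (mkseq u N.+1) i | i <- l] = s by [].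
rewrite ls; apply/eq_in_map => k kl; rewrite nth_mkseq// ltnS /N leq_max.
by rewrite (leq_bigmax_seq _ kl)// orbT.
Qed.

Lemma countably_compact_hausdorff_compact :
  countably_compact [set: X] -> cover_compact [set: X].
Proof.
move=> ccX J D f f_open fT; apply: contrapT => lX.
have [u [Q [clQ lQ QS uQ decide]]] := exists_deciding_sequence f_open lX.
have [g clg] := countably_compact_cluster ccX u.
have Qg := cluster_decreasing_closed clQ QS uQ clg.
have [i Di fig] := fT g I.
(* A second point of all the Q n: one outside a member f i of the cover that
   contains g. *)
have [x Qx] : exists x, forall n, (Q n `\` f i) x.
  apply: (countably_compact_bigcap ccX) => [n|n|n x [/QS]//].
    by rewrite setDE; apply: closedI => //; exact/open_closedC/f_open.
  apply: contrapT => Qf; apply: (lQ n); exists (fset1 i).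
    by move=> j; rewrite in_fset1 inE => /eqP->.
  move=> y Qy; exists i; first by rewrite /= in_fset1.
  by apply: contrapT => nfy; apply: Qf; exists y.
have [U nU [s [e e0 sepU]]] : exists2 U, nbhs g U & exists s, exists2 e, 0 < e &
    forall t, U t -> ~ upper_nbhd x s e t.
  apply: contrapT => nosep; have : g = x; last first.
    by move=> gx; have [_] := Qx 0; rewrite -gx.
  apply: X_hausdorff => U V nU /nbhs_upperP[s [e e0 sV]]; apply: contrapT => UV.
  apply: nosep; exists U => //; exists s, e => // t Ut st.
  by apply: UV; exists t; split=> //; exact: sV.
have [m _ /(_ _ (leqnn m)) /= me] := near_infty_natSinv_lt (PosNum e0).
(* A basic neighbourhood of g, with as many points as the one of x, that
   contains no term of u lying in U. *)
have [t tB|G GP] :=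
    @tuple_compactness (size s) [set t | range u t /\ U t] g m.+1%:R^-1.
  have [N NP] := decide t (size s) m (fun z zt => (tB z zt).1).
  have [|G GP] := NP x g (Qx N).1 (Qg N); last first.
    by exists G => z zt; have [j /ltW] := GP z zt; exists j.
  exists (tnth (in_tuple s)) => z zt; apply: contrapT => noj.
  apply: (sepU z (tB z zt).2) => y /seq_tnthP[j ->].
  rewrite ltNge; apply/negP => le_j; apply: noj; exists j.
  by apply: lt_le_trans le_j; rewrite ltrD2l.
have e'0 : 0 < m.+1%:R^-1 :> R by rewrite invr_gt0.
have uT : (u @ \oo) (range u) by exists 0 => // n _; exists n.
have nG := nbhs_upper g (map G (enum 'I_(size s))) e'0.
have [t [ut [Ut]]] := clg _ _ uT (filterI nU nG).
have [j Gj /(_ (G j))] := GP t (conj ut Ut).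
by rewrite map_f ?mem_enum// ltNge Gj => /(_ isT).
Qed.

(** * Convergent sequences in compact Hausdorff spaces of functions *)

Hypothesis X_compact : compact [set: X].

(** By [closure_range_separated] countably many neighbourhoods of [b] have [b] as
their only common point in the closure of [u]; replacing them by neighbourhoods
with closures inside them, any cluster point of [v] is still in all of them. *)
Lemma range_countable_base (u : nat -> X) (b : X) :
  exists2 O : nat -> set X, (forall n, nbhs b (O n)) &
    forall v : nat -> X, (forall n, range u (v n)) -> (forall n, O n (v n)) ->
      v @ \oo --> b.
Proof.
have [D DP] := closure_range_separated u b.
pose E n := flatten (mkseq D n.+1).
have /choice[N NP] n : exists N, nbhs b N /\
    closure N `<=` upper_nbhd b (E n) n.+1%:R^-1.
  have regb : {for b, regular_space X}.
    exact: (compact_regular X_hausdorff X_compact filterT).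
  have [|N nN NE] := regb (upper_nbhd b (E n) n.+1%:R^-1).
    by apply: nbhs_upper; rewrite invr_gt0.
  by exists N.
exists (fun n => [set f | forall k : 'I_n.+1, N k f]) => [n|v uv Nv].
  by apply: filter_forall => k; exact: (NP k).1.
apply: (compact_cluster_set1 X_hausdorff X_compact filterT) => //.
  exact: filterT.
have vP : ProperFilter (v @ \oo) by exact: fmap_proper_filter.
have cl_b f : cluster (v @ \oo) f -> f = b.
  move=> clf; apply: DP => [U nU|n d dD].
    have vu : (v @ \oo) (range u) by exists 0 => // n _; exact: uv.
    exact: clf.
  apply/ler_addgt0Pr => e e0.
  have [m _ /(_ _ (leq_maxl m n)) /= me] := near_infty_natSinv_lt (PosNum e0).
  set j := maxn m n in me.
  have fN : closure (N j) f.
    move=> U nU; apply: clf nU; exists j => // i ji.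
    exact: (Nv i (Ordinal (ji : (j < i.+1)%N))).
  have dE : d \in E j.
    by apply/flattenP; exists (D n) => //; apply/mapP; exists n => //;
      rewrite mem_iota leq0n add0n ltnS leq_maxr.
  by apply/ltW/(lt_trans ((NP j).2 _ fN _ dE)); rewrite ltrD2l.
rewrite predeqE => f; split=> [/cl_b//|->].
have [g [_ clg]] := X_compact vP filterT.
by rewrite -(cl_b g).
Qed.

Lemma compact_sequentially_compact (u : nat -> X) :
  exists2 s : nat -> nat, {homo s : m n / (m < n)%N} &
    exists l : X, (u \o s) @ \oo --> l.
Proof.
have uP : ProperFilter (u @ \oo) by exact: fmap_proper_filter.
have [b [_ clb]] := X_compact uP filterT.
have [V nV VP] := range_countable_base u b.
have later (k n : nat) : exists m, (k < m)%N /\ V n (u m).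
  have uk : (u @ \oo) (u @` [set m | (k < m)%N]).
    by exists k.+1 => // m km; exists m.
  by have [_ [[m km <-] Om]] := clb _ _ uk (nV n); exists m.
pose g k n := projT1 (cid (later k n)).
pose s := fix s n := if n is m.+1 then g (s m) n else g 0 0.
have sS n : (s n < s n.+1)%N by rewrite /=/g; case: cid => m [].
exists s; first by apply: homo_ltn => //; exact: ltn_trans.
exists b; apply: VP => n; first by exists (s n).
by case: n => [|n] /=; rewrite /g; case: cid => m [].
Qed.

Lemma compact_frechet_urysohn : frechet_urysohn X.
Proof.
move=> B b /countable_tightness[u uB ub].
have [V nV VP] := range_countable_base u b.
have /choice[k kP] n : exists k, V n (u k).
  by have [_ [[k _ <-] Ok]] := ub _ (nV n); exists k.
by exists (u \o k) => [n|]; [exact: uB | apply: VP => // n; exists (k n)].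
Qed.

End UpperPointwise.

(** * Passage to the subspace [A] of [C_a(K)] *)

Section Subspace.
Variables (T : topologicalType) (A : set T).

Lemma set_val_surj x : A x -> exists y : A, set_val y = x.
Proof. by move=> Ax; exists (exist _ x (mem_set Ax)). Qed.

Lemma nbhs_set_typeP (x : A) (U : set A) :
  nbhs x U <-> exists2 V, nbhs (set_val x) V & set_val @^-1` V `<=` U.
Proof.
split=> [|[V nV VU]]; last first.
  exact: filterS VU (@initial_continuous A T set_val x V nV).
rewrite (@nbhsE A x) => -[_ [[V oV <-] Vx] VU]; exists V; last exact: VU.
exact: (open_nbhs_nbhs (conj oV Vx)).
Qed.

Lemma cover_set_type (J : Type) (D : set J) (f : J -> set T) :
  A `<=` cover D f <-> [set: A] `<=` cover D (fun i => set_val @^-1` f i).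
Proof.
split=> [Af x _|Af x /set_val_surj[y <-]]; last first.
  by have [i Di fi] := Af y I; exists i.
by have [i Di fi] := Af _ (set_valP x); exists i.
Qed.

Lemma finite_subset_cover_set_type (I : choiceType) (D : set I)
    (f : I -> set T) :
  finite_subset_cover D f A <->
  finite_subset_cover D (fun i => set_val @^-1` f i) [set: A].
Proof. by split=> -[s sD /cover_set_type sA]; exists s. Qed.

Lemma open_set_type (I : Type) (D : set I) (g : I -> set A) :
  (forall i, D i -> open (g i)) -> exists2 f : I -> set T,
    forall i, D i -> open (f i) & forall i, D i -> set_val @^-1` f i = g i.
Proof.
move=> og.
have /choice[f fP] i : exists V, D i -> open V /\ set_val @^-1` V = g i.
  have [Di|nDi] := pselect (D i); last by exists setT.
  by have [V oV gE] := og i Di; exists V.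
by exists f => i /fP[].
Qed.

Lemma cover_pull (I : choiceType) (D : set I) (g : I -> set A) :
  (forall (f : I -> set T), (forall i, D i -> open (f i)) ->
    A `<=` cover D f -> finite_subset_cover D f A) ->
  (forall i, D i -> open (g i)) -> [set: A] `<=` cover D g ->
  finite_subset_cover D g [set: A].
Proof.
move=> cA /open_set_type[f of_ fE] covg.
have covf : A `<=` cover D f.
  by apply/cover_set_type => x /covg[i Di gi]; exists i; rewrite // fE.
have /finite_subset_cover_set_type[s sD sA] := cA f of_ covf.
exists s => // x /sA[i si fi]; exists i => //.
by rewrite -fE//; have := sD _ si; rewrite inE.
Qed.

Lemma cover_compact_set_type : cover_compact A <-> cover_compact [set: A].
Proof.
split=> [cA I D g og covg|cA I D f of_ /cover_set_type covf].
  by apply: cover_pull => // f; exact: cA.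
apply/finite_subset_cover_set_type; apply: cA covf => i Di.
by exists (f i) => //; exact: of_.
Qed.

Lemma countably_compact_set_type :
  countably_compact A -> countably_compact [set: A].
Proof. by move=> cA D g og covg; apply: cover_pull => // f; exact: cA. Qed.

End Subspace.

Lemma ptws_nbhs_gt (R : realType) (K : topologicalType)
    (h : {ptws K -> R}) (z : K) (c : R) :
  c < h z -> nbhs h [set f : {ptws K -> R} | c < f z].
Proof.
move=> ch.
have pc : {for h, continuous (fun f : {ptws K -> R} => f z)}.
  exact: (@proj_continuous K (fun=> R) z).
exact: (cvgr_gt (h z) pc c ch).
Qed.

Section Ca.
Variables (R : realType) (K : topologicalType) (A : set (Ca K R)).

Let ev (x : A) : K -> R := fun_of_Ca (set_val x).

Lemma fun_of_Ca_continuous (f : Ca K R) : continuous (fun_of_Ca f).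
Proof. exact: cts_fun. Qed.

(** The centre of a basic set containing [f] can be moved to [f] itself. *)
Lemma nbhs_CaP (f : Ca K R) (U : set (Ca K R)) : nbhs f U <->
  exists (s : seq K), exists2 e, 0 < e & Ca_basic f [set` s] e `<=` U.
Proof.
split.
  rewrite nbhsE => -[_ [[B BD <-] [W BW Wf]] sU].
  have [g [F [e [finF e0 WE]]]] := BD _ BW.
  have Bf : Ca_basic g F e f by rewrite -WE.
  have [d d0 dP] := Ca_basic_shrink finF Bf.
  have /finite_seqP[s sF] := finF.
  exists s, d => // h hs; apply: sU; exists W => //=; rewrite WE => x Fx.
  by apply: lt_le_trans (dP x Fx); apply: hs; rewrite -sF.
move=> [s [e e0 sU]]; apply: filterS sU _; apply: open_nbhs_nbhs; split.
  exists [set Ca_basic f [set` s] e]; last by rewrite bigcup_set1.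
  by move=> _ ->; exists f, [set` s], e.
by move=> x _; rewrite ltrDl.
Qed.

Lemma nbhs_subCaP (x : A) (U : set A) : nbhs x U <->
  exists s, exists2 e, 0 < e & upper_nbhd ev x s e `<=` U.
Proof.
rewrite nbhs_set_typeP; split=> [[V /nbhs_CaP[s [e e0 sV]] VU]|[s [e e0 sU]]].
  by exists s, e => // y ys; apply/VU/sV => z /ys.
exists (Ca_basic (set_val x) [set` s] e); last first.
  by move=> y ys; apply: sU => z /ys.
by apply/nbhs_CaP; exists s, e.
Qed.

Lemma Cp_nbhs_gt (h : Cp K R) (z : K) (c : R) :
  c < fun_of_Ca h z -> nbhs h [set g : Cp K R | c < fun_of_Ca g z].
Proof.
move=> /ptws_nbhs_gt gt_nbhs.
have := @initial_continuous _ {ptws K -> R}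
  (fun f : continuousType K R => Continuous.sort f) h _ gt_nbhs.
exact.
Qed.

Lemma Ca_open_lt (z : K) (c : R) : open [set g : Ca K R | fun_of_Ca g z < c].
Proof.
rewrite openE => g gc; apply/nbhs_CaP; exists [:: z], (c - fun_of_Ca g z).
  by rewrite subr_gt0.
by move=> k /(_ z (mem_head _ _)); rewrite subrKC.
Qed.

(** The cover is indexed by the points [(x, c)] strictly below the graph of [h]:
it covers [A] exactly when no member of [A] dominates [h], and each of its
members is avoided by all functions pointwise close to [h]. *)
Lemma compact_Cp_closure : cover_compact A ->
  closure (A : set (Cp K R)) `<=` down_closure A.
Proof.
move=> cA h clh; apply: contrapT => nh.
have [||s sD sA] := cA _ [set p : K * R | p.2 < fun_of_Ca h p.1]
    (fun p => [set g | fun_of_Ca g p.1 < p.2]).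
- by move=> p _; exact: Ca_open_lt.
- move=> g Ag; have [x gx] : exists x, fun_of_Ca g x < fun_of_Ca h x.
    apply: contrapT => hg; apply: nh; exists g => // x.
    by rewrite leNgt; apply/negP => gx; apply: hg; exists x.
  exists (x, (fun_of_Ca g x + fun_of_Ca h x) / 2) => /=.
    by rewrite /mkset/= midf_lt.
  by rewrite midf_lt.
have nh_j (j : 'I_(size (enum_fset s)))
    (p := tnth (in_tuple (enum_fset s)) j) :
    nbhs (h : Cp K R) [set g | p.2 < fun_of_Ca g p.1].
  apply: Cp_nbhs_gt.
  by have /sD := mem_tnth j (in_tuple (enum_fset s)); rewrite inE.
have nh_s := filter_forall (nbhs_filter (h : Cp K R)) nh_j.
have [g [Ag]] := clh _ nh_s.
have [p /= /seq_tnthP[j ->] gp /(_ j)] := sA g Ag.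
by rewrite ltNge (ltW gp).
Qed.

End Ca.

Theorem corollary5p18 (R : realType) (K : topologicalType)
    (K_compact : compact [set: K]) (K_hausdorff : hausdorff_space K)
    (A : set (Ca K R)) (A_hausdorff : hausdorff_space (set_type A)) :
  [<-> cover_compact A;
       countably_compact A /\
         closure (A : set (Cp K R)) `<=` down_closure A;
       sequentially_compact A /\
         closure (A : set (Cp K R)) `<=` down_closure A ] /\
  (cover_compact A ->
     frechet_urysohn (set_type A) /\ angelic (set_type A)).
Proof.
pose ev (x : A) : K -> R := fun_of_Ca (set_val x).
have ev_cont x : continuous (ev x) by exact: fun_of_Ca_continuous.
have nbhsA := @nbhs_subCaP R K A.
have compactA : cover_compact A -> compact [set: A].
  by move=> /cover_compact_set_type /compactP_cover.
have cc_compact : countably_compact A -> cover_compact A.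
  move=> /countably_compact_set_type ccA; apply/cover_compact_set_type.
  exact: (countably_compact_hausdorff_compact
            K_compact ev_cont nbhsA A_hausdorff).
split; last first.
  move=> /compactA cA.
  have FU := compact_frechet_urysohn K_compact ev_cont nbhsA A_hausdorff cA.
  split=> // B _; split; last exact: FU.
  move=> J D f of_ fT; have /compactP_cover cA' := cA.
  by have [s sD sT] := cA' _ _ _ of_ fT; exists s => // x _; exact: sT.
tfae.
- move=> cA; split; last exact: compact_Cp_closure.
  by move=> D f; exact: cA.
- move=> [/cc_compact/compactA cA clA]; split=> // u uA.
  have /choice[v vu] n := set_val_surj (uA n).
  have [s s_incr [l vl]] :=
    compact_sequentially_compact K_compact ev_cont nbhsA A_hausdorff cA v.
  exists s => //; exists (set_val l); first exact: set_valP.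
  have -> : u \o s = set_val \o (v \o s) by apply/funext => n /=; rewrite vu.
  exact: (cvg_comp _ _ vl (@initial_continuous A _ set_val l)).
- by move=> [/sequentially_countably_compact /cc_compact].
Qed.
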